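(* Let $\mathcal{A}=\{A_1,\dots,A_m\}\subseteq\mathbb{S}^n$ and suppose there exists $\bar x\in\mathbb{R}^n$ such that $\bar x^\top A_i\bar x<0$ for all $i\in\{1,\dots,m\}$. Then the following are equivalent: (a) For all $A_{\mathrm{obj}}\in\mathbb{S}^n$, the implication $$x^\top A_ix\le0\ \ \forall i\in\{1,\dots,m\}\quad\Longrightarrow\quad x^\top A_{\mathrm{obj}}x\ge0$$ holds for all $x\in\mathbb{R}^n$ if and only if there exists $\gamma\in\mathbb{R}^m_+$ such that $A_{\mathrm{obj}}+\sum_{i=1}^m\gamma_iA_i\succeq0$. (b) $\mathcal{S}(\mathcal{A})$ is rank-one generated.
   Context: $\mathbb{S}^n$ is the space of real symmetric $n\times n$ matrices, $\mathbb{S}^n_+$ the cone of positive semidefinite matrices, $A\succeq0$ means $A\in\mathbb{S}^n_+$, and $\langle\cdot,\cdot\rangle$ is the trace inner product. $\mathbb{R}^m_+$ is the nonnegative orthant. For $\mathcal{A}\subseteq\mathbb{S}^n$, $$\mathcal{S}(\mathcal{A})=\{X\in\mathbb{S}^n:\ X\succeq0,\ \langle A,X\rangle\le0\ \ \forall A\in\mathcal{A}\}.$$ A closed convex cone $\mathcal{S}\subseteq\mathbb{S}^n_+$ is rank-one generated (ROG) if $\mathcal{S}=\mathrm{conv}(\mathcal{S}\cap\{zz^\top:z\in\mathbb{R}^n\})$. *)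

(* Defs.v *)
From mathcomp Require Import all_boot all_order all_algebra.
From mathcomp Require Import classical_sets reals convex.

Set Implicit Arguments.
Unset Strict Implicit.
Unset Printing Implicit Defensive.

Import Order.TTheory GRing.Theory Num.Theory.

Local Open Scope classical_set_scope.
Local Open Scope ring_scope.

Definition quad_form (R : realType) (n : nat) (A : 'M[R]_n) (x : 'cV[R]_n) : R :=
  (x^T *m A *m x) 0 0.

Definition trace_inner (R : realType) (n : nat) (A X : 'M[R]_n) : R :=
  \tr (A^T *m X).

Definition psd_cone (R : realType) (n : nat) : set 'M[R]_n :=
  [set X | X \is symmetricmx /\ forall x : 'cV[R]_n, 0 <= quad_form X x].

Definition S_cone (R : realType) (n : nat) (As : set 'M[R]_n) : set 'M[R]_n :=
  [set X | psd_cone X /\ forall A, As A -> trace_inner A X <= 0].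

Definition conv_hull (R : realType) (V : lmodType R) (B : set V) : set V :=
  smallest (@convex_set R V) B.

Definition rank_one_matrices (R : realType) (n : nat) : set 'M[R]_n :=
  [set X | exists z : 'cV[R]_n, X = z *m z^T].

(* Meant for closed convex cones S contained in psd_cone; every S_cone As is
   one, so these side conditions are not repeated here. *)
Definition rank_one_generated (R : realType) (n : nat) (S : set 'M[R]_n) : Prop :=
  S = conv_hull (S `&` @rank_one_matrices R n).

(* Main.v *)
(** Let [K] be the cone of the matrices [sum_k z_k z_k^T + sum_i g_i B_i] with
    [n * n] vectors [z_k] satisfying finitely many homogeneous quadratic
    inequalities and with [g_i >= 0].  By Caratheodory's argument [K] is convex,
    and a positive definite [Y] with [<Y, B_i> > 0] makes the parametrization
    coercive, so that every matrix has a nearest point in [K].  Hence a symmetric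
    matrix outside [K] is strictly separated from [K].

    If the S-cone is rank-one generated, separate [Aobj] from [K] with [z_k]
    unconstrained and [B_i = - A_i]: the separating matrix lies in the S-cone,
    hence in the hull of its rank-one elements, on which [Aobj] is nonnegative.
    Slater's condition provides [Y].  Conversely, if some [X] in the S-cone is
    not in the hull of the rank-one elements, separate it from [K] with [z_k]
    feasible and no [B_i]; the multipliers given by (a) for the separating
    matrix contradict [<M, X> >= 0] for positive semidefinite [M]. *)

Require Import Defs.
From mathcomp Require Import all_boot all_order all_algebra.
From mathcomp Require Import boolp classical_sets reals topology normedtype.
From mathcomp Require Import derive convex.
From mathcomp Require Import interval_inference ring lra.

Import Order.TTheory GRing.Theory Num.Theory.
Import numFieldNormedType.Exports.

Local Open Scope classical_set_scope.
Local Open Scope ring_scope.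

Set Implicit Arguments.
Unset Strict Implicit.
Unset Printing Implicit Defensive.

(** * The trace inner product and its link with quadratic forms *)

Section TraceInner.
Context {R : realType} {n : nat}.
Implicit Types (A B D E X Y : 'M[R]_n) (z : 'cV[R]_n).

Lemma symmetricmxP X : reflect (X^T = X) (X \is symmetricmx).
Proof.
by apply: (iffP (is_hermitianmxP _ _ _)); rewrite expr0 scale1r map_mx_id.
Qed.

Lemma trace_innerE A X : trace_inner A X = \sum_i \sum_j A i j * X i j.
Proof.
rewrite /trace_inner /mxtrace exchange_big /=; apply: eq_bigr => i _.
by rewrite mxE; apply: eq_bigr => j _; rewrite mxE.
Qed.

Lemma trace_innerC A X : trace_inner A X = trace_inner X A.
Proof.
rewrite !trace_innerE; apply: eq_bigr => i _; apply: eq_bigr => j _.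
by rewrite mulrC.
Qed.

Lemma trace_innerDr A X Y :
  trace_inner A (X + Y) = trace_inner A X + trace_inner A Y.
Proof. by rewrite /trace_inner mulmxDr mxtraceD. Qed.

Lemma trace_innerZr A t X : trace_inner A (t *: X) = t * trace_inner A X.
Proof. by rewrite /trace_inner -scalemxAr mxtraceZ. Qed.

Lemma trace_innerNr A X : trace_inner A (- X) = - trace_inner A X.
Proof. by rewrite -scaleN1r trace_innerZr mulN1r. Qed.

Lemma trace_inner0r A : trace_inner A 0 = 0.
Proof. by rewrite /trace_inner mulmx0 mxtrace0. Qed.

Lemma trace_inner_sumr (I : finType) A (F : I -> 'M[R]_n) :
  trace_inner A (\sum_i F i) = \sum_i trace_inner A (F i).
Proof. by rewrite /trace_inner mulmx_sumr raddf_sum. Qed.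

Lemma trace_innerDl A B X :
  trace_inner (A + B) X = trace_inner A X + trace_inner B X.
Proof. by rewrite !(trace_innerC _ X) trace_innerDr. Qed.

Lemma trace_innerZl t A X : trace_inner (t *: A) X = t * trace_inner A X.
Proof. by rewrite !(trace_innerC _ X) trace_innerZr. Qed.

Lemma trace_innerNl A X : trace_inner (- A) X = - trace_inner A X.
Proof. by rewrite !(trace_innerC _ X) trace_innerNr. Qed.

Lemma trace_inner_suml (I : finType) (F : I -> 'M[R]_n) X :
  trace_inner (\sum_i F i) X = \sum_i trace_inner (F i) X.
Proof.
by rewrite trace_innerC trace_inner_sumr; apply: eq_bigr => i _;
  rewrite trace_innerC.
Qed.

Lemma trace_inner_sqr_ge0 D : 0 <= trace_inner D D.
Proof.
rewrite trace_innerE; apply: sumr_ge0 => i _; apply: sumr_ge0 => j _.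
by rewrite -expr2 sqr_ge0.
Qed.

Lemma trace_inner_sqr_eq0 D : trace_inner D D = 0 -> D = 0.
Proof.
rewrite trace_innerE => /eqP; rewrite psumr_eq0 => [/allP D0|i _]; last first.
  by apply: sumr_ge0 => j _; rewrite -expr2 sqr_ge0.
apply/matrixP => i j; rewrite mxE.
have := D0 i (mem_index_enum _); rewrite psumr_eq0 => [/allP|k _]; last first.
  by rewrite -expr2 sqr_ge0.
by move=> /(_ j (mem_index_enum _)) /=; rewrite mulf_eq0 orbb => /eqP.
Qed.

Lemma trace_inner_sqrD D E t :
  trace_inner (D + t *: E) (D + t *: E) =
  trace_inner D D + 2 * t * trace_inner D E + t ^+ 2 * trace_inner E E.
Proof.
rewrite trace_innerDr !trace_innerDl !trace_innerZr !trace_innerZl.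
by rewrite (trace_innerC E D); ring.
Qed.

Lemma trace_inner_le_sqr D E :
  2 * trace_inner D E <= trace_inner D D + trace_inner E E.
Proof.
have := trace_inner_sqr_ge0 (D + (-1) *: E).
by rewrite trace_inner_sqrD; lra.
Qed.

(** First-order optimality: if [<D, E>] were negative, a short step along [E] would decrease the
    norm. *)
Lemma trace_inner_ge0_of_min D E :
  (forall t, 0 <= t <= 1 ->
    trace_inner D D <= trace_inner (D + t *: E) (D + t *: E)) ->
  0 <= trace_inner D E.
Proof.
move=> Dmin; rewrite leNgt; apply/negP => d_lt0.
set d := trace_inner D E in d_lt0; set q := trace_inner E E.
have q0 : 0 <= q by exact: trace_inner_sqr_ge0.
have s_gt0 : 0 < q - d by lra.
(* The minimizing step is [- d / q]; enlarging the denominator to [q - d] keeps the step in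
   [[0, 1]], and the norm still decreases. *)
have t01 : 0 <= - d / (q - d) <= 1.
  rewrite ler_pdivrMr // mul1r lerDr q0 andbT.
  by rewrite divr_ge0 // ?oppr_ge0 ltW.
have := Dmin _ t01; rewrite trace_inner_sqrD -/d -/q -addrA lerDl.
set t := - d / (q - d).
have tE : t * (q - d) = - d by rewrite /t divfK ?gt_eqF.
have t_gt0 : 0 < t by rewrite divr_gt0 ?oppr_gt0.
by nra.
Qed.

Lemma trace_inner_rank_one A z : trace_inner A (z *m z^T) = quad_form A z.
Proof.
rewrite /trace_inner /quad_form mulmxA mxtrace_mulC mulmxA trace_mx11.
(* Transposing this scalar matrix turns [A^T] into [A]. *)
by rewrite -[in RHS](mxE trmx_key (fun i j => (z^T *m A *m z) j i)) -/(trmx _)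
  !trmx_mul trmxK mulmxA.
Qed.

Lemma quad_formE A z : quad_form A z = \sum_i \sum_j A i j * (z i 0 * z j 0).
Proof.
rewrite -trace_inner_rank_one trace_innerE; apply: eq_bigr => i _.
by apply: eq_bigr => j _; rewrite mxE big_ord1 mxE.
Qed.

Lemma rank_oneZ t z : (t *: z) *m (t *: z)^T = t ^+ 2 *: (z *m z^T).
Proof. by rewrite linearZ /= -scalemxAr -scalemxAl scalerA. Qed.

Lemma quad_form0 A : quad_form A 0 = 0.
Proof. by rewrite /quad_form mulmx0 mxE. Qed.

Lemma quad_formZ A t z : quad_form A (t *: z) = t ^+ 2 * quad_form A z.
Proof. by rewrite -!trace_inner_rank_one rank_oneZ trace_innerZr. Qed.

Lemma quad_formDl A B z : quad_form (A + B) z = quad_form A z + quad_form B z.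
Proof. by rewrite -!trace_inner_rank_one trace_innerDl. Qed.

Lemma symmetricmx_rank_one z : z *m z^T \is symmetricmx.
Proof. by apply/symmetricmxP; rewrite trmx_mul trmxK. Qed.

Lemma symmetricmxD A B :
  A \is symmetricmx -> B \is symmetricmx -> A + B \is symmetricmx.
Proof.
by move=> /symmetricmxP sA /symmetricmxP sB; apply/symmetricmxP;
  rewrite linearD /= sA sB.
Qed.

Lemma symmetricmxZ t A : A \is symmetricmx -> t *: A \is symmetricmx.
Proof.
by move=> /symmetricmxP sA; apply/symmetricmxP; rewrite linearZ /= sA.
Qed.

Lemma symmetricmx_sum (I : finType) (F : I -> 'M[R]_n) :
  (forall i, F i \is symmetricmx) -> \sum_i F i \is symmetricmx.
Proof.
move=> sF; apply/symmetricmxP; rewrite raddf_sum; apply: eq_bigr => i _.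
exact/symmetricmxP.
Qed.

End TraceInner.

(** * Positive semidefinite matrices have nonnegative inner products *)

Section PSD.
Context {R : realType} {n : nat}.
Implicit Types (M X : 'M[R]_n) (z : 'cV[R]_n).

Lemma quad_form_rank_one (v z : 'cV[R]_n) :
  quad_form (v *m v^T) z = ((v^T *m z) 0 0) ^+ 2.
Proof.
rewrite /quad_form mulmxA -mulmxA mxE big_ord1 expr2; congr (_ * _).
by rewrite !mxE; apply: eq_bigr => i _; rewrite !mxE mulrC.
Qed.

Lemma quad_form_addcol X z t j : X \is symmetricmx ->
  quad_form X (z + t *: delta_mx j 0) =
  quad_form X z + 2 * t * ((col j X)^T *m z) 0 0 + t ^+ 2 * X j j.
Proof.
move=> /symmetricmxP sX; rewrite /quad_form.
have -> : (z + t *: delta_mx j 0)^T = z^T + t *: delta_mx 0 j.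
  by rewrite linearD linearZ /= trmx_delta.
rewrite !mulmxDl !mulmxDr -!scalemxAl -!scalemxAr.
have e1 : z^T *m X *m delta_mx j 0 = (col j X)^T *m z.
  rewrite -[RHS]trmxK trmx_mul trmxK colE -mulmxA; apply/matrixP => a b.
  by rewrite !ord1 [in RHS]mxE.
have e2 : (delta_mx 0 j : 'rV_n) *m X *m z = (col j X)^T *m z.
  by rewrite -rowE -[in LHS]sX -tr_col.
have e3 : ((delta_mx 0 j : 'rV_n) *m X *m delta_mx j (0 : 'I_1)) 0 0 = X j j.
  by rewrite -rowE -colE !mxE.
rewrite e1 e2 !mxE; move: e3; rewrite !mxE => ->; ring.
Qed.

Lemma psd_diag_ge0 X j : psd_cone X -> 0 <= X j j.
Proof.
move=> [sX /(_ (0 + 1 *: delta_mx j 0))]; rewrite quad_form_addcol //.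
by rewrite mulmx0 mxE quad_form0; lra.
Qed.

Lemma psd_diag0_col X i j : psd_cone X -> X j j = 0 -> X i j = 0.
Proof.
move=> [sX pX] Xj; apply: contrapT => /eqP Xij.
(* Since [X j j = 0], the form is affine in the coefficient of the [j]-th basis vector, with slope
   [2 * X i j]; this coefficient makes its value [-1]. *)
have /= := pX (delta_mx i 0 +
  (- (quad_form X (delta_mx i 0) + 1) / (2 * X i j)) *: delta_mx j 0).
rewrite quad_form_addcol // Xj -colE !mxE.
set q := quad_form _ _.
have -> : q + 2 * (- (q + 1) / (2 * X i j)) * X i j +
          (- (q + 1) / (2 * X i j)) ^+ 2 * 0 = -1 by field.
by rewrite ler0N1.
Qed.

(* Symmetric Gaussian elimination: subtracting a rank-one matrix kills the
   pivot row and column, and keeps the matrix positive semidefinite. *)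
Lemma psd_pivot X j : psd_cone X -> X j j != 0 ->
  psd_cone (X - (X j j)^-1 *: (col j X *m (col j X)^T)).
Proof.
move=> [sX pX] Xj; split.
  by rewrite -scaleNr; apply/symmetricmxD/symmetricmxZ/symmetricmx_rank_one.
move=> z; set v := (col j X)^T *m z.
(* This shift minimizes the form of [X] along coordinate [j]; the minimum is the value at [z] of the
   form of the pivoted matrix. *)
have := pX (z + (- v 0 0 / X j j) *: delta_mx j 0).
rewrite quad_form_addcol // -/v => h.
rewrite -scaleNr quad_formDl -[X in _ + X]trace_inner_rank_one trace_innerZl.
rewrite trace_inner_rank_one quad_form_rank_one -/v.
by move: h; congr (_ <= _); field.
Qed.

(** Induction on the number of nonzero diagonal entries of [X]: each pivot splits off a nonnegative
    multiple of some [v *m v^T], whose inner product with [M] is a value of the form of [M]. No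
    spectral decomposition is involved. *)
Lemma psd_trace_inner_ge0 M X : psd_cone M -> psd_cone X -> 0 <= trace_inner M X.
Proof.
move=> pM; have [r] := ubnP #|[pred j | X j j != 0]|.
elim: r X => // r IHr X Xr pX.
have [j /= Xj|X0] := pickP [pred j | X j j != 0]; last first.
  suff -> : X = 0 by rewrite trace_inner0r.
  apply/matrixP => i j; rewrite mxE; apply: psd_diag0_col => //.
  by apply/eqP/negbFE/X0.
set v := col j X.
have -> : X = (X - (X j j)^-1 *: (v *m v^T)) + (X j j)^-1 *: (v *m v^T).
  by rewrite subrK.
rewrite trace_innerDr trace_innerZr trace_inner_rank_one addr_ge0 //; last first.
  by rewrite mulr_ge0 ?invr_ge0 ?psd_diag_ge0 //; case: pM.
apply: IHr; last exact: psd_pivot.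
(* A zero diagonal entry stays zero because its whole row and column vanish, while entry [j] becomes
   zero. *)
rewrite -ltnS (leq_trans _ Xr) // ltnS; apply: proper_card; apply/properP; split.
  apply/fintype.subsetP => i; rewrite !inE; apply: contra => /eqP Xi.
  have /symmetricmxP/matrixP/(_ i j) := pX.1; rewrite mxE => Xji.
  by rewrite !mxE big_ord1 !mxE Xi -Xji (psd_diag0_col j pX Xi) mul0r mulr0 subr0.
by exists j; rewrite !inE // negbK !mxE big_ord1 !mxE mulKf // subrr.
Qed.

End PSD.

(** * Continuity of sums and products of real functions *)

Section RealContinuity.
Context {R : realType}.

Lemma continuous_sumr (T : topologicalType) (I : finType) (F : I -> T -> R) :
  (forall i, continuous (F i)) -> continuous (fun x => \sum_i F i x).
Proof. by move=> cF; apply: continuous_big => //; exact: add_continuous. Qed.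

Lemma continuous_addr (T : topologicalType) (f g : T -> R) :
  continuous f -> continuous g -> continuous (fun x => f x + g x).
Proof. by move=> cf cg x; exact: (cvgD (cf x) (cg x)). Qed.

Lemma continuous_mulr (T : topologicalType) (f g : T -> R) :
  continuous f -> continuous g -> continuous (fun x => f x * g x).
Proof. by move=> cf cg x; exact: (cvgM (cf x) (cg x)). Qed.

End RealContinuity.

(** * Caratheodory reduction for sums of rank-one matrices *)

Section Caratheodory.
Context {R : realType} {n : nat}.

Definition rank_one_sum (N : nat) (z : 'I_N -> 'cV[R]_n) : 'M[R]_n :=
  \sum_k z k *m (z k)^T.

(** There is one more matrix than the dimension [n * n], hence a nontrivial relation; changing its
    sign if necessary makes some coefficient positive. *)
Lemma rank_one_dependence (z : 'I_(n * n).+1 -> 'cV[R]_n) :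
  exists2 c : 'I_(n * n).+1 -> R,
    \sum_k c k *: (z k *m (z k)^T) = 0 & exists k, 0 < c k.
Proof.
pose V := \matrix_k mxvec (z k *m (z k)^T).
have : kermx V != 0.
  rewrite kermx_eq0 -row_leq_rank -ltnNge ltnS; exact: rank_leq_col.
case/rowV0Pn => c /sub_kermxP cV c0.
have Vsum : \sum_k c 0 k *: (z k *m (z k)^T) = 0.
  apply: (can_inj mxvecK); rewrite linear0 -cV mulmx_sum_row linear_sum.
  by apply: eq_bigr => k _; rewrite linearZ /= rowK.
have [k ck] : exists k, c 0 k != 0.
  apply: contrapT => /forallNP c0'; move/eqP: c0; apply; apply/rowP => k.
  by rewrite mxE; apply/eqP/negPn/negP/c0'.
move: ck; rewrite neq_lt => /orP[ck|ck]; last by exists (c 0) => //; exists k.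
exists (fun k => - c 0 k); last by exists k; rewrite oppr_gt0.
under eq_bigr do rewrite scaleNr.
by rewrite sumrN Vsum oppr0.
Qed.

(* Moving along a linear dependence until the first coefficient vanishes. *)
Lemma rank_one_sum_reduce (F : set 'cV[R]_n) (z : 'I_(n * n).+1 -> 'cV[R]_n) :
    (forall t x, F x -> F (t *: x)) -> (forall k, F (z k)) ->
  exists2 w : 'I_(n * n) -> 'cV[R]_n,
    forall k, F (w k) & rank_one_sum w = rank_one_sum z.
Proof.
move=> FZ Fz; have [c c0 [k1 ck1]] := rank_one_dependence z.
(* With [c k0] maximal, all weights [1 - c k / c k0] are nonnegative and the one at [k0] is zero;
   their square roots are absorbed into the vectors. *)
pose k0 := [arg max_(k > k1) c k]%O.
have ck0 k : c k <= c k0 by rewrite /k0; case: arg_maxP => // i _; apply.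
have c_gt0 : 0 < c k0 by exact: lt_le_trans (ck0 k1).
exists (fun k => Num.sqrt (1 - c (lift k0 k) / c k0) *: z (lift k0 k)).
  by move=> k; exact: FZ.
transitivity (\sum_k (1 - c k / c k0) *: (z k *m (z k)^T)).
  rewrite (bigD1_ord k0) //= divff ?gt_eqF // subrr scale0r add0r.
  apply: eq_bigr => k _; rewrite rank_oneZ sqr_sqrtr //.
  by rewrite subr_ge0 ler_pdivrMr // mul1r.
under eq_bigr do rewrite scalerBl scale1r mulrC -scalerA.
by rewrite sumrB -scaler_sumr c0 scaler0 subr0.
Qed.

End Caratheodory.

(** * Nearest points in the generated cone, and separation *)

Section Projection.
Context {R : realType} {n r p : nat}.
Variables (A : 'I_r -> 'M[R]_n) (B : 'I_p -> 'M[R]_n).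

Definition feasible (z : 'cV[R]_n) : Prop := forall i, quad_form (A i) z <= 0.

Lemma feasible0 : feasible 0.
Proof. by move=> i; rewrite quad_form0. Qed.

Lemma feasibleZ t z : feasible z -> feasible (t *: z).
Proof. by move=> Fz i; rewrite quad_formZ mulr_ge0_le0 ?sqr_ge0. Qed.

Definition cone_point (N : nat) (z : 'I_N -> 'cV[R]_n) (g : 'I_p -> R) :=
  rank_one_sum z + \sum_i g i *: B i.

(** Fixing the number [N] of vectors makes the parameter space finite-dimensional, so that
    compactness applies to it. *)
Definition gen_cone (N : nat) : set 'M[R]_n :=
  [set C | exists z g, [/\ forall k, feasible (z k), forall i, 0 <= g i &
                           C = @cone_point N z g]].

Lemma gen_coneZ N t C : 0 <= t -> gen_cone N C -> gen_cone N (t *: C).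
Proof.
move=> t0 [z [g [Fz g0 ->]]].
exists (fun k => Num.sqrt t *: z k), (fun i => t * g i); split.
- by move=> k; exact: feasibleZ.
- by move=> i; rewrite mulr_ge0.
rewrite /cone_point /rank_one_sum scalerDr !scaler_sumr; congr (_ + _).
  by apply: eq_bigr => k _; rewrite rank_oneZ sqr_sqrtr.
by apply: eq_bigr => i _; rewrite scalerA.
Qed.

Lemma gen_coneD_gen N C i t : 0 <= t -> gen_cone N C ->
  gen_cone N (C + t *: B i).
Proof.
move=> t0 [z [g [Fz g0 ->]]].
exists z, (fun j => g j + (j == i)%:R * t); split => //.
  by move=> j; rewrite addr_ge0 // mulr_ge0.
rewrite /cone_point -addrA; congr (_ + _).
under [in RHS]eq_bigr do rewrite scalerDl.
rewrite big_split /=; congr (_ + _); rewrite (bigD1 i) //= eqxx mul1r.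
by rewrite big1 ?addr0 // => j /negbTE ->; rewrite mul0r scale0r.
Qed.

(** Appending [x] gives [n * n + 1] vectors, which the Caratheodory reduction brings back to
    [n * n]; feasibility is invariant under scaling. *)
Lemma gen_coneD_rank_one C x : feasible x -> gen_cone (n * n) C ->
  gen_cone (n * n) (C + x *m x^T).
Proof.
move=> Fx [z [g [Fz g0 ->]]].
pose z' (k : 'I_(n * n).+1) := oapp z x (unlift ord0 k).
have [|w Fw wE] := @rank_one_sum_reduce _ _ feasible z' feasibleZ.
  by move=> k; rewrite /z'; case: unlift => //=.
exists w, g; split => //; rewrite /cone_point wE addrAC; congr (_ + _).
rewrite /rank_one_sum big_ord_recl /z' unlift_none /= addrC; congr (_ + _).
by apply: eq_bigr => k _; rewrite liftK.
Qed.

Lemma gen_cone_sym N C : (forall i, B i \is symmetricmx) -> gen_cone N C ->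
  C \is symmetricmx.
Proof.
move=> sB [z [g [_ _ ->]]]; apply: symmetricmxD; apply: symmetricmx_sum => k.
  exact: symmetricmx_rank_one.
exact: symmetricmxZ.
Qed.

Section Existence.
Variables (N : nat) (Y : 'M[R]_n) (e : R).
Hypothesis e_gt0 : 0 < e.
Hypothesis Ypos : forall z : 'cV[R]_n,
  e * \sum_i (z i 0) ^+ 2 <= quad_form Y z.
Hypothesis YB : forall i, e <= trace_inner Y (B i).

(** Coercivity: every summand has a nonnegative inner product with [Y], so each one alone is at most
    [M]. *)
Lemma cone_point_bounded z g M :
    (forall i, 0 <= g i) -> trace_inner Y (@cone_point N z g) <= M ->
  (forall k i, `|z k i 0| <= 1 + M / e) /\ (forall i, g i <= 1 + M / e).
Proof.
move=> g0; rewrite trace_innerDr !trace_inner_sumr => YM.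
have Yz k : 0 <= trace_inner Y (z k *m (z k)^T).
  rewrite trace_inner_rank_one; apply: le_trans (Ypos _).
  by apply: mulr_ge0; [exact: ltW|apply: sumr_ge0 => i _; exact: sqr_ge0].
have Yg i : 0 <= trace_inner Y (g i *: B i).
  by rewrite trace_innerZr mulr_ge0 // (le_trans (ltW e_gt0)).
split=> [k i|i].
  have zM : e * (z k i 0) ^+ 2 <= M.
    apply: le_trans (_ : e * \sum_i (z k i 0) ^+ 2 <= _).
      rewrite ler_pM2l // (bigD1 i) //= lerDl.
      by apply: sumr_ge0 => j _; exact: sqr_ge0.
    apply: le_trans (Ypos _) _; rewrite -trace_inner_rank_one.
    apply: le_trans YM; rewrite (bigD1 k) //= -addrA lerDl addr_ge0 //.
      exact: sumr_ge0.
    exact: sumr_ge0.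
  have {}zM : `|z k i 0| ^+ 2 <= M / e.
    by rewrite real_normK ?num_real // ler_pdivlMr // mulrC.
  (* The inequality [2 * a <= a ^+ 2 + 1] replaces a square root, so a single bound serves both the
     vectors and the multipliers. *)
  have := sqr_ge0 (`|z k i 0| - 1); rewrite sqrrB1.
  have := normr_ge0 (z k i 0); move: zM; nra.
have gM : e * g i <= M.
  apply: le_trans YM; rewrite (bigD1 i) //= addrCA trace_innerZr.
  apply: le_trans (_ : g i * trace_inner Y (B i) <= _).
    by rewrite mulrC ler_wpM2l.
  by rewrite lerDl addr_ge0 // sumr_ge0.
by rewrite (@le_trans _ _ (M / e)) ?lerDr // ler_pdivlMr // mulrC.
Qed.

(** All parameters are flattened into one row vector, since compactness of boxes is used for row
    vectors. *)
Let dim := (n * N + p)%N.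
Let vz (v : 'rV[R]_dim) (k : 'I_N) : 'cV[R]_n :=
  \col_i v 0 (lshift p (mxvec_index i k)).
Let vg (v : 'rV[R]_dim) (i : 'I_p) : R := v 0 (rshift (n * N) i).

Let continuous_vz k i : continuous (fun v => vz v k i 0).
Proof.
have -> : (fun v => vz v k i 0) = (fun v => v 0 (lshift p (mxvec_index i k))).
  by apply/funext => v; rewrite mxE.
exact: coord_continuous.
Qed.

Let continuous_vg i : continuous (fun v => vg v i).
Proof. exact: coord_continuous. Qed.

Let encode (z : 'I_N -> 'cV[R]_n) (g : 'I_p -> R) : 'rV[R]_dim :=
  row_mx (mxvec (\matrix_(i, k) z k i 0)) (\row_i g i).

Let vz_encode z g : vz (encode z g) = z.
Proof.
apply/funext => k; apply/colP => i.
by rewrite mxE /encode row_mxEl mxvecE mxE.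
Qed.

Let vg_encode z g : vg (encode z g) = g.
Proof. by apply/funext => i; rewrite /vg /encode row_mxEr mxE. Qed.

Let continuous_quad_form M k : continuous (fun v => quad_form M (vz v k)).
Proof.
under eq_fun do rewrite quad_formE.
apply: continuous_sumr => i; apply: continuous_sumr => j.
apply: continuous_mulr; first exact: cst_continuous.
by apply: continuous_mulr; exact: continuous_vz.
Qed.

Let continuous_cone_point i j :
  continuous (fun v => cone_point (vz v) (vg v) i j).
Proof.
have -> : (fun v => cone_point (vz v) (vg v) i j) = (fun v =>
    \sum_k vz v k i 0 * vz v k j 0 + \sum_l vg v l * B l i j).
  apply/funext => v; rewrite mxE !summxE; congr (_ + _); apply: eq_bigr => k _.
    by rewrite mxE big_ord1 [in X in _ * X]mxE.
  by rewrite mxE.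
apply: continuous_addr; apply: continuous_sumr => k; apply: continuous_mulr.
- exact: continuous_vz.
- exact: continuous_vz.
- exact: continuous_vg.
- exact: cst_continuous.
Qed.

(** The distance is minimized over a compact set [K] of parameters, which contains all those whose
    point is at least as close to [X] as the apex [0]. *)
Lemma gen_cone_nearest X : exists2 C, gen_cone N C &
  forall C', gen_cone N C' ->
    trace_inner (C - X) (C - X) <= trace_inner (C' - X) (C' - X).
Proof.
pose f v := trace_inner (cone_point (vz v) (vg v) - X)
                        (cone_point (vz v) (vg v) - X).
have cf : continuous f.
  rewrite /f; under eq_fun do rewrite trace_innerE.
  apply: continuous_sumr => i; apply: continuous_sumr => j.
  suff cij : continuous (fun v => (cone_point (vz v) (vg v) - X) i j).
    by apply: continuous_mulr; exact: cij.
  have -> : (fun v => (cone_point (vz v) (vg v) - X) i j) =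
            (fun v => cone_point (vz v) (vg v) i j + (- X) i j).
    by apply/funext => v; rewrite mxE.
  by apply: continuous_addr; [exact: continuous_cone_point|exact: cst_continuous].
(* This bounds [<Y, C>] when [C] is no farther from [X] than [0] is, by
   [2 <Y, C - X> <= <Y, Y> + <C - X, C - X>]. *)
pose M := trace_inner Y X + (trace_inner Y Y + trace_inner X X) / 2.
pose b := 1 + M / e.
pose K := [set v : 'rV[R]_dim | forall i, `[- b, b]%classic (v ord0 i)] `&`
  ((\bigcap_(ik : 'I_r * 'I_N) [set v | quad_form (A ik.1) (vz v ik.2) <= 0]) `&`
   (\bigcap_(i : 'I_p) [set v | 0 <= vg v i])).
have cK : compact K.
  apply: compact_closedI.
    by apply: (@rV_compact _ _ (fun=> `[- b, b]%classic)) => _; exact: segment_compact.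
  apply: closedI; apply: closed_bigI => i _.
    exact: ((continuous_closedP _).1 (@continuous_quad_form _ _) _ (@closed_le R 0)).
  exact: ((continuous_closedP _).1 (@continuous_vg _) _ (@closed_ge R 0)).
have inK z g : (forall k, feasible (z k)) -> (forall i, 0 <= g i) ->
    trace_inner (cone_point z g - X) (cone_point z g - X) <= trace_inner X X ->
    K (encode z g).
  move=> Fz g0 zX.
  have YM : trace_inner Y (cone_point z g) <= M.
    have := trace_inner_le_sqr Y (cone_point z g - X).
    by rewrite trace_innerDr trace_innerNr /M; lra.
  have [zb gb] := cone_point_bounded g0 YM.
  split; last split.
  - move=> i; rewrite /= in_itv /= -ler_norml.
    case: (split_ordP i) => j ->.
      rewrite /encode row_mxEl; case/mxvec_indexP: j => a k.
      by rewrite mxvecE mxE; exact: zb.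
    by rewrite /encode row_mxEr mxE ger0_norm //; exact: gb.
  - by move=> [i k] _ /=; rewrite vz_encode; exact: Fz.
  - by move=> i _ /=; rewrite vg_encode.
have f0 : trace_inner (cone_point (fun _ : 'I_N => 0) (fun=> 0) - X)
   (cone_point (fun _ : 'I_N => 0) (fun=> 0) - X) = trace_inner X X.
  rewrite /cone_point /rank_one_sum !big1 ?add0r => [|i _|k _].
  - by rewrite trace_innerNl trace_innerNr opprK.
  - by rewrite scale0r.
  - by rewrite mul0mx.
have K0 : K (encode (fun=> 0) (fun=> 0)).
  apply: inK => //; last by rewrite f0.
  by move=> _; exact: feasible0.
have [|v /set_mem [_ [Fv gv]] vmin] := compact_EVT_min _ cK
    (continuous_subspaceT cf); first by exists (encode (fun=> 0) (fun=> 0)).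
exists (cone_point (vz v) (vg v)).
  exists (vz v), (vg v); split => // [k i|i]; last exact: gv.
  exact: (Fv (i, k)).
move=> _ [z [g [Fz g0 ->]]].
(* A competitor farther from [X] than [0] loses to [0], whose parameters are in [K]; any other
   competitor is itself parametrized in [K]. *)
case: (leP (trace_inner (cone_point z g - X) (cone_point z g - X))
           (trace_inner X X)) => [zX|/ltW zX].
  by have := vmin _ (mem_set (inK _ _ Fz g0 zX)); rewrite /f vz_encode vg_encode.
apply: le_trans zX.
by have := vmin _ (mem_set K0); rewrite /f vz_encode vg_encode f0.
Qed.

End Existence.

(** The separating matrix is [C - X], where [C] is a nearest point. Optimality is tested in the
    directions [z *m z^T], [B i] and [- C], along which [C] can move inside the cone. *)
Lemma gen_cone_separation (Y : 'M[R]_n) (e : R) (X : 'M[R]_n) :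
    0 < e -> (forall z : 'cV[R]_n,
  e * \sum_i (z i 0) ^+ 2 <= quad_form Y z) ->
    (forall i, e <= trace_inner Y (B i)) ->
    (forall i, B i \is symmetricmx) -> X \is symmetricmx ->
    ~ gen_cone (n * n) X ->
  exists D : 'M[R]_n, [/\ D \is symmetricmx,
    forall z, feasible z -> 0 <= quad_form D z,
    forall i, 0 <= trace_inner D (B i) & trace_inner D X < 0].
Proof.
move=> e0 Yp YB sB sX XK; have [C KC Cmin] := gen_cone_nearest (n * n) e0 Yp YB X.
have Dge0 E : (forall t, 0 <= t <= 1 -> gen_cone (n * n) (C + t *: E)) ->
    0 <= trace_inner (C - X) E.
  move=> KE; apply: trace_inner_ge0_of_min => t t01; rewrite addrAC.
  exact/Cmin/KE.
exists (C - X); split.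
- rewrite -scaleN1r; apply/symmetricmxD/symmetricmxZ => //.
  exact: gen_cone_sym KC.
- move=> z Fz; rewrite -trace_inner_rank_one; apply: Dge0 => t /andP[t0 _].
  by rewrite -(sqr_sqrtr t0) -rank_oneZ; apply/gen_coneD_rank_one/KC/feasibleZ.
- by move=> i; apply: Dge0 => t /andP[t0 _]; exact: gen_coneD_gen.
(* Moving from [C] towards the apex stays in the cone; with [D = C - X], this yields
   [<D, X> = <D, C> - <D, D> < 0]. *)
have DC : trace_inner (C - X) C <= 0.
  rewrite -oppr_ge0 -trace_innerNr; apply: Dge0 => t /andP[_ t1].
  by rewrite scalerN -[X in X - _]scale1r -scalerBl; apply: gen_coneZ => //; lra.
have D_gt0 : 0 < trace_inner (C - X) (C - X).
  rewrite lt_def trace_inner_sqr_ge0 andbT; apply/eqP => /trace_inner_sqr_eq0.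
  by move/eqP; rewrite subr_eq0 => /eqP CX; apply: XK; rewrite -CX.
by move: D_gt0; rewrite [X in _ < X]trace_innerDr trace_innerNr; lra.
Qed.

End Projection.

(** * Convex hulls of scaling-invariant sets of rank-one matrices *)

Section ConvexHull.
Context {R : realType} {n : nat}.

Lemma sub_conv_hull (V : lmodType R) (B : set V) : B `<=` conv_hull B.
Proof. exact: sub_gen_smallest. Qed.

Lemma conv_hull_min (V : lmodType R) (B C : set V) :
  (forall (t : R) x y, 0 <= t <= 1 -> C x -> C y -> C (t *: x + (1 - t) *: y)) ->
  B `<=` C -> conv_hull B `<=` C.
Proof.
move=> cC BC; apply: smallest_sub => // x y l /set_mem Cx /set_mem Cy.
by apply/mem_set/cC => //; rewrite ge0 le1.
Qed.

Lemma conv_hull_midpoint (V : lmodType R) (B : set V) x y :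
  conv_hull B x -> conv_hull B y -> conv_hull B (2^-1 *: x + 2^-1 *: y).
Proof.
move=> Bx By C [cC BC].
have Cx := mem_set (Bx C (conj cC BC)); have Cy := mem_set (By C (conj cC BC)).
have half_ge0 : 0 <= 2^-1 :> R by lra.
have half_le1 : 2^-1 <= 1 :> R by lra.
pose h := Itv01 half_ge0 half_le1; have /set_mem := cC _ _ h Cx Cy.
have -> // : conv h (x : convex_lmodType V) y = 2^-1 *: x + 2^-1 *: y.
by rewrite -{2}(_ : 1 - 2^-1 = 2^-1 :> R); last lra.
Qed.

(** As [F] is stable under scaling, a sum is the midpoint of its two doubled terms, so midpoints
    alone build every conic combination. *)
Lemma rank_one_sum_conv_hull (F : set 'cV[R]_n) (N : nat) (z : 'I_N -> 'cV[R]_n) :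
    F 0 -> (forall t x, F x -> F (t *: x)) -> (forall k, F (z k)) ->
  conv_hull [set x *m x^T | x in F] (rank_one_sum z).
Proof.
move=> F0 FZ; rewrite /rank_one_sum; elim: N z => [|N IHN] z Fz.
  by rewrite big_ord0; apply: sub_conv_hull; exists 0 => //; rewrite mul0mx.
have half (x : 'cV[R]_n) :
    2^-1 *: ((Num.sqrt 2 *: x) *m (Num.sqrt 2 *: x)^T) = x *m x^T.
  by rewrite rank_oneZ sqr_sqrtr // scalerA mulVf ?scale1r ?pnatr_eq0.
rewrite big_ord_recr /= -[z ord_max *m _]half.
under eq_bigr do rewrite -half.
rewrite -scaler_sumr; apply: conv_hull_midpoint.
  by apply: (IHN (fun k => _ *: z (widen_ord _ k))) => k; exact: FZ.
by apply: sub_conv_hull; exists (Num.sqrt 2 *: z ord_max) => //; exact: FZ.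
Qed.

End ConvexHull.

(** * The S-cone and the two implications *)

Section SCone.
Context {R : realType} {n m : nat}.
Variable A : 'I_m -> 'M[R]_n.

Lemma psd_rank_one (z : 'cV[R]_n) : psd_cone (z *m z^T).
Proof.
split=> [|x]; first exact: symmetricmx_rank_one.
by rewrite quad_form_rank_one sqr_ge0.
Qed.

Lemma S_coneP X :
  S_cone (range A) X <-> psd_cone X /\ forall i, trace_inner (A i) X <= 0.
Proof.
split=> -[pX AX]; split=> //; first by move=> i; apply: AX; exists i.
by move=> _ [i _ <-].
Qed.

Lemma S_cone_rank_one :
  S_cone (range A) `&` @rank_one_matrices R n =
  [set z *m z^T | z in feasible A].
Proof.
apply/seteqP; split=> [X [/S_coneP[_ AX] [z Xz]]|_ [z Fz <-]].
  by exists z => // i; rewrite -trace_inner_rank_one -Xz.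
split; last by exists z.
apply/S_coneP; split; first exact: psd_rank_one.
by move=> i; rewrite trace_inner_rank_one.
Qed.

Lemma S_cone_convex (t : R) X Y : 0 <= t <= 1 ->
  S_cone (range A) X -> S_cone (range A) Y ->
  S_cone (range A) (t *: X + (1 - t) *: Y).
Proof.
move=> /andP[t0 t1] /S_coneP[[sX pX] AX] /S_coneP[[sY pY] AY].
have t1' : 0 <= 1 - t by rewrite subr_ge0.
apply/S_coneP; split; first split.
- by apply: symmetricmxD; apply: symmetricmxZ.
- move=> z; rewrite -trace_inner_rank_one trace_innerDl !trace_innerZl.
  by rewrite !trace_inner_rank_one addr_ge0 // mulr_ge0.
- move=> i; rewrite trace_innerDr !trace_innerZr.
  by rewrite -oppr_ge0 opprD -!mulrN addr_ge0 // mulr_ge0 // oppr_ge0.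
Qed.

Lemma quad_form1 (z : 'cV[R]_n) : quad_form 1%:M z = \sum_i (z i 0) ^+ 2.
Proof.
rewrite /quad_form mulmx1 mxE; apply: eq_bigr => i _.
by rewrite mxE expr2.
Qed.

(* [Y] is a Slater point of the semidefinite relaxation: a large multiple of
   [xbar xbar^T] plus the identity. *)
Lemma slater_matrix (xbar : 'cV[R]_n) : (forall i, quad_form (A i) xbar < 0) ->
  exists Y : 'M[R]_n,
    (forall z : 'cV[R]_n, 1 * \sum_i (z i 0) ^+ 2 <= quad_form Y z) /\
    forall i, 1 <= trace_inner Y (- A i).
Proof.
(* The weight [c i] outweighs the contribution of the identity to [<Y, - A i>] with a margin of [1];
   being nonnegative, the weights can be summed to serve all [i] at once. *)
move=> xA; pose c i := (1 + `|trace_inner 1%:M (A i)|) / - quad_form (A i) xbar.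
have c0 i : 0 <= c i by rewrite divr_ge0 ?addr_ge0 // oppr_ge0 ltW.
exists ((\sum_i c i) *: (xbar *m xbar^T) + 1%:M); split=> [z|i].
  rewrite mul1r quad_formDl quad_form1 lerDr -trace_inner_rank_one trace_innerZl.
  rewrite trace_inner_rank_one quad_form_rank_one mulr_ge0 ?sqr_ge0 //.
  exact: sumr_ge0.
rewrite trace_innerNr trace_innerDl trace_innerZl (trace_innerC (xbar *m _)).
rewrite trace_inner_rank_one opprD -mulrN.
have ci : c i <= \sum_i c i by rewrite (bigD1 i) //= lerDl sumr_ge0.
have := ler_wpM2r (_ : 0 <= - quad_form (A i) xbar) ci.
rewrite oppr_ge0 ltW // => /(_ isT).
rewrite /c divfK ?oppr_eq0 ?lt_eqF // => h.
have := ler_norm (trace_inner 1%:M (A i)); lra.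
Qed.

(** The easy half of (a): at a feasible [x] the multiplier terms are nonpositive, so removing them
    can only increase the form. *)
Lemma S_lemma_suff (Aobj : 'M[R]_n) (g : 'rV[R]_m) (x : 'cV[R]_n) :
    (forall i, 0 <= g 0 i) -> psd_cone (Aobj + \sum_i g 0 i *: A i) ->
  feasible A x -> 0 <= quad_form Aobj x.
Proof.
move=> g0 [_ /(_ x)]; rewrite quad_formDl -(trace_inner_rank_one (\sum_i _)).
rewrite trace_inner_suml => pos Fx; apply: le_trans pos _; rewrite gerDl.
apply: sumr_le0 => i _; rewrite trace_innerZl trace_inner_rank_one.
exact: mulr_ge0_le0.
Qed.

Lemma psd_rank_one_sum N (z : 'I_N -> 'cV[R]_n) : psd_cone (rank_one_sum z).
Proof.
split=> [|x]; first by apply: symmetricmx_sum => k; exact: symmetricmx_rank_one.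
rewrite -trace_inner_rank_one trace_inner_suml sumr_ge0 // => k _.
by rewrite trace_inner_rank_one quad_form_rank_one sqr_ge0.
Qed.

Hypothesis sA : forall i, A i \is symmetricmx.

Lemma rog_S_lemma (xbar : 'cV[R]_n) (Aobj : 'M[R]_n) :
    (forall i, quad_form (A i) xbar < 0) -> Aobj \is symmetricmx ->
    rank_one_generated (S_cone (range A)) ->
    (forall x, feasible A x -> 0 <= quad_form Aobj x) ->
  exists g : 'rV[R]_m, (forall i, 0 <= g 0 i) /\
    psd_cone (Aobj + \sum_i g 0 i *: A i).
Proof.
move=> /slater_matrix[Y [Ypos YA]] sObj rog obj_ge0; apply: contrapT => no_g.
(* The empty family ['I_0] leaves the vectors unconstrained; a representation of [Aobj] in this cone
   would supply the multipliers. *)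
have notK : ~ gen_cone (fun i : 'I_0 => 0) (fun i => - A i) (n * n) Aobj.
  move=> [z [g [_ g0 objE]]]; apply: no_g; exists (\row_i g i).
  split=> [i|]; first by rewrite mxE.
  rewrite objE /cone_point -addrA -big_split big1 /= => [|i _].
    by rewrite addr0; exact: psd_rank_one_sum.
  by rewrite mxE scalerN addNr.
have sNA i : - A i \is symmetricmx by rewrite -scaleN1r symmetricmxZ.
have [D [sD pD DA]] := gen_cone_separation ltr01 Ypos YA sNA sObj notK.
rewrite trace_innerC ltNge => /negP; apply.
have : S_cone (range A) D.
  apply/S_coneP; split=> [|i]; first by split=> // z; apply: pD => -[].
  by rewrite trace_innerC -oppr_ge0 -trace_innerNr.
(* The half-space of matrices with nonnegative inner product with [Aobj] is convex and contains the
   feasible rank-one matrices, hence their hull and [D]. *)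
rewrite rog S_cone_rank_one; move: D {sD pD DA}.
apply: conv_hull_min => [t X X' /andP[t0 t1] X0 X'0|_ [z Fz <-]] /=.
  by rewrite trace_innerDr !trace_innerZr addr_ge0 // mulr_ge0 // subr_ge0.
by rewrite trace_inner_rank_one; exact: obj_ge0.
Qed.

Lemma S_lemma_rog :
    (forall Aobj : 'M[R]_n, Aobj \is symmetricmx ->
      (forall x, feasible A x -> 0 <= quad_form Aobj x) ->
      exists g : 'rV[R]_m, (forall i, 0 <= g 0 i) /\
        psd_cone (Aobj + \sum_i g 0 i *: A i)) ->
  rank_one_generated (S_cone (range A)).
Proof.
move=> S_lemma; apply/seteqP; split; last first.
  by apply: conv_hull_min => [|X []//]; exact: S_cone_convex.
move=> X /S_coneP[pX AX]; rewrite S_cone_rank_one.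
(* Without generators [B], the cone consists of sums of feasible rank-one matrices, all of which lie
   in the hull. *)
have [[z [g [Fz _ ->]]]|notK] :=
    pselect (gen_cone A (fun i : 'I_0 => 0) (n * n) X).
  rewrite /cone_point big_ord0 addr0; apply: rank_one_sum_conv_hull => //.
    exact: feasible0.
  exact: feasibleZ.
have Ipos (z : 'cV[R]_n) : 1 * \sum_i (z i 0) ^+ 2 <= quad_form 1%:M z.
  by rewrite mul1r quad_form1.
(* The identity serves as [Y]; the conditions on the [B i] are vacuous. *)
have [|i|D [sD FD _ DX]] := gen_cone_separation ltr01 Ipos _ _ pX.1 notK.
- by case.
- by case: i.
(* The matrix [D + \sum_i g 0 i *: A i] is positive semidefinite, yet its inner product with [X] is
   at most [<D, X> < 0]. *)
have [g [g0 /psd_trace_inner_ge0/(_ pX)]] := S_lemma D sD FD.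
rewrite trace_innerDl trace_inner_suml leNgt => /negP[].
rewrite -[X in _ < X]addr0 ltr_leD // sumr_le0 // => i _.
by rewrite trace_innerZl mulr_ge0_le0.
Qed.

End SCone.

Theorem corollary1 (R : realType) (n m : nat) (A : 'I_m -> 'M[R]_n)
    (hA : forall i, A i \is symmetricmx)
    (hbar : exists xbar : 'cV[R]_n, forall i, quad_form (A i) xbar < 0) :
  (forall Aobj : 'M[R]_n, Aobj \is symmetricmx ->
     ((forall x : 'cV[R]_n,
         (forall i, quad_form (A i) x <= 0) -> 0 <= quad_form Aobj x)
      <->
      (exists gamma : 'rV[R]_m,
         (forall i, 0 <= gamma 0 i) /\
         psd_cone (Aobj + \sum_(i < m) gamma 0 i *: A i))))
  <->
  rank_one_generated (S_cone (range A)).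
Proof.
case: hbar => xbar xA; split=> [S_lemma|rog Aobj sObj].
  by apply: S_lemma_rog => Aobj sObj; exact: (S_lemma Aobj sObj).1.
split; first exact: rog_S_lemma xA sObj rog.
by move=> [g [g0 pg]] x; exact: S_lemma_suff g0 pg.
Qed.
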